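(* For any finite tree $T$ with at least three vertices: (i) $\mathrm{fgndi}_{\sum}(T)=1$ if $T$ contains no two adjacent vertices of the same degree; and (ii) $\mathrm{fgndi}_{\sum}(T)=2$ if $T$ contains two adjacent vertices of the same degree.
   Context: For a finite simple graph $G$ and an integer $k\ge 1$, a non-proper total $k$-coloring is an arbitrary map $f: V(G)\cup E(G)\rightarrow \{1,2,\dots,k\}$. Its weight function is $$\phi(x)=f(x)+\sum_{e\ni x}f(e)+\sum_{y\in N(x)}f(y)\quad (x\in V(G)),$$ where the first sum is over the edges $e$ incident with $x$ and $N(x)=\{y\in V(G): xy\in E(G)\}$. The coloring $f$ is called a neighbor full sum distinguishing (NFSD) total $k$-coloring if $\phi(x)\neq\phi(y)$ for every edge $xy\in E(G)$. The neighbor full sum distinguishing total chromatic number $\mathrm{fgndi}_{\sum}(G)$ is the smallest $k$ for which $G$ has an NFSD total $k$-coloring. *)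

(* Defs.v *)
From HB Require Import structures.
From mathcomp Require Import all_boot.

Set Implicit Arguments.
Unset Strict Implicit.
Unset Printing Implicit Defensive.

Record sgraph := SGraph {
  vertex :> finType;
  adj : rel vertex;
  adj_sym : symmetric adj;
  adj_irr : irreflexive adj
}.

Definition edges (G : sgraph) : {set {set G}} :=
  [set A : {set G} |
    [exists x : G, exists y : G, adj x y && (A == [set x; y])]].

Definition edge (G : sgraph) : finType := {A : {set G} | A \in edges G}.

Lemma mem_edges (G : sgraph) (x y : G) : ([set x; y] \in edges G) = adj x y.
Proof.
rewrite inE; apply/existsP/idP => [[u /existsP[v /andP[uv /eqP E]]]|xy]; last first.
  by exists x; apply/existsP; exists y; rewrite xy /=.
have uvN : u != v by apply: contraTneq uv => ->; rewrite adj_irr.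
have := set21 u v; have := set22 u v; rewrite -E !inE.
case/orP => /eqP Ev; case/orP => /eqP Eu; move: uv uvN E; rewrite {}Eu {}Ev ?eqxx //.
by rewrite adj_sym.
Qed.

Definition neighbors (G : sgraph) (x : G) : {set G} := [set y | adj x y].

Definition degree (G : sgraph) (x : G) : nat := #|neighbors x|.

Definition connected_graph (G : sgraph) : Prop :=
  0 < #|G| /\ forall x y : G, connect (@adj G) x y.

(* A [ucycle] may have one or two vertices (a closed walk x, y, x through a
   single edge is a [ucycle] of length 2), hence the bound on the length. *)
Definition acyclic_graph (G : sgraph) : Prop :=
  forall c : seq G, 2 < size c -> ~ ucycle (@adj G) c.

Definition tree (G : sgraph) : Prop := connected_graph G /\ acyclic_graph G.

Definition total_coloring (G : sgraph) (k : nat) (f : G + edge G -> nat) : Prop :=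
  forall z, 1 <= f z <= k.

Definition weight (G : sgraph) (f : G + edge G -> nat) (x : G) : nat :=
  f (inl x) + \sum_(e : edge G | x \in val e) f (inr e)
            + \sum_(y in neighbors x) f (inl y).

Definition NFSD (G : sgraph) (k : nat) (f : G + edge G -> nat) : Prop :=
  total_coloring k f /\ forall x y : G, adj x y -> weight f x <> weight f y.

Definition has_NFSD (G : sgraph) (k : nat) : Prop :=
  exists f : G + edge G -> nat, NFSD k f.

(* "The NFSD total chromatic number of G is k", as a relation: the number is
   undefined for graphs without any NFSD total coloring, such as K_2. *)
Definition is_fgndi (G : sgraph) (k : nat) : Prop :=
  [/\ 1 <= k, has_NFSD G k & forall j, 1 <= j -> has_NFSD G j -> k <= j].

(* Main.v *)
Require Import Defs.
From mathcomp Require Import all_boot.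

(** A coloring constantly equal to 1 gives [x] the weight [1 + 2 * degree x],
    and it is the only coloring with one color; so one color suffices exactly
    when adjacent vertices always have different degrees.

    With two colors, all vertices keep color 1 and only the edges are colored.
    A tree is bipartite, and two adjacent vertices are told apart as soon as
    their weights have the parity prescribed by their sides of the bipartition.
    Swapping the two colors along a path changes the parity of the weight at
    the two ends of the path only; hence in a connected graph the parities can
    be prescribed freely at all vertices but one, [r]
    ([exists_edge_parity]).  Take for [r] a leaf ([acyclic_has_leaf]): the only
    edge at [r] is also an edge at its neighbor [y], and [y] has larger degree
    because the tree has at least three vertices, so the weight of [r] is
    smaller than that of [y] whatever the colors of the edges are
    ([weight_leaf_lt]). *)

Set Implicit Arguments.
Unset Strict Implicit.
Unset Printing Implicit Defensive.

Section Graph.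

Variable G : sgraph.
Implicit Types (x y z r : G) (e : edge G) (f : G + edge G -> nat).

(** * Incident edges and weights *)

Lemma edge_other_end x e :
  x \in val e -> exists2 y, adj x y & val e = [set x; y].
Proof.
case: e => A /= hA; move: (hA); rewrite inE.
case/existsP=> u /existsP[v /andP[uv /eqP ->]].
rewrite !inE => /orP[] /eqP ->; first by exists v.
by exists u; rewrite 1?adj_sym // setUC.
Qed.

Lemma card_incident_edges x :
  #|[set e : edge G | x \in val e]| = degree x.
Proof.
rewrite -(card_imset _ val_inj).
have -> : [set val e | e in [set e : edge G | x \in val e]]
          = [set [set x; y] | y in neighbors x].
  apply/setP => A; apply/imsetP/imsetP => [[e]|[y]].
    rewrite inE => /edge_other_end[y xy E] ->.
    by exists y => //; rewrite inE.
  rewrite inE => xy ->; have h : [set x; y] \in edges G by rewrite mem_edges.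
  by exists (Sub [set x; y] h) => //; rewrite inE /= set21.
apply: card_in_imset => y z; rewrite !inE => xy xz E.
have : y \in [set x; z] by rewrite -E set22.
by rewrite !inE => /orP[/eqP Ey|/eqP //]; rewrite Ey adj_irr in xy.
Qed.

(** All vertices get color 1, and the colors of the edges are shifted by 1, so
    that a [bool]-valued [g] yields a 2-coloring. *)
Definition edge_coloring (g : edge G -> nat) (z : G + edge G) : nat :=
  if z is inr e then (g e).+1 else 1.

Lemma weight_edge_coloring (g : edge G -> nat) x :
  weight (edge_coloring g) x =
  (degree x).*2.+1 + \sum_(e : edge G | x \in val e) g e.
Proof.
rewrite /weight /=; under eq_bigr do rewrite -add1n.
rewrite big_split /= !sum1_card -/(degree x).
have -> : #|[pred e : edge G | x \in val e]| = degree x.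
  by rewrite -card_incident_edges cardsE.
by rewrite -addnn add1n !addSn addnAC.
Qed.

Lemma weight_const1 f x : f =1 (fun=> 1) -> weight f x = (degree x).*2.+1.
Proof.
move=> f1; transitivity (weight (edge_coloring (fun=> 0)) x).
  by rewrite /weight f1; congr (_ + _ + _); apply: eq_bigr => *; rewrite f1.
by rewrite weight_edge_coloring big1 ?addn0.
Qed.

Lemma has_NFSD1P :
  has_NFSD G 1 <-> ~ exists x y : G, adj x y /\ degree x = degree y.
Proof.
split=> [[f [f1 fN]] [x [y [xy dxy]]]|nodeg].
  have f1' : f =1 (fun=> 1) by move=> z; apply/eqP; rewrite eqn_leq andbC f1.
  by apply: (fN x y xy); rewrite !weight_const1 // dxy.
exists (fun=> 1); split=> // x y xy; rewrite !weight_const1 // => -[/double_inj E].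
by apply: nodeg; exists x, y.
Qed.

(** * Prescribing parities by coloring edges *)

(** Adding up modulo 2 the edges of a walk from [x] to [r], every passage
    through an inner vertex uses two edges, so only the ends remain. *)
Lemma path_edge_parity x r : connect (@adj G) x r ->
  exists g : edge G -> bool, forall z,
    \big[addb/false]_(e : edge G | z \in val e) g e = (z == x) (+) (z == r).
Proof.
case/connectP=> p; elim: p x => [|y p IHp] x /=.
  by move=> _ ->; exists xpred0 => z; rewrite big1 // addbb.
case/andP=> xy /IHp{}IHp /IHp[g hg].
have h : [set x; y] \in edges G by rewrite mem_edges.
pose exy : edge G := Sub [set x; y] h.
exists (fun e => g e (+) (e == exy)) => z.
rewrite big_split /= hg.
have -> : \big[addb/false]_(e : edge G | z \in val e) (e == exy)
          = (z == x) (+) (z == y).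
  have -> : (z == x) (+) (z == y) = (z \in val exy).
    rewrite !inE; have [->|_] //= := eqVneq z x.
    by have [Exy|//] := eqVneq x y; rewrite Exy adj_irr in xy.
  rewrite big_mkcond (bigD1 exy) //= eqxx big1 ?addbF; first by case: ifP.
  by move=> e /negPf ->; rewrite if_same.
by case: (z == x); case: (z == y); case: (z == r).
Qed.

(** The solutions of [path_edge_parity] for all the walks from a vertex of [t]
    to [r] are added up modulo 2; the surplus of ones is collected at [r]. *)
Lemma exists_edge_parity r (t : pred G) :
  (forall x, connect (@adj G) x r) ->
  exists g : edge G -> bool, forall x, x != r ->
    \big[addb/false]_(e : edge G | x \in val e) g e = t x.
Proof.
move=> conn.
have [g hg] := fin_all_exists (fun x => path_edge_parity (conn x)).
exists (fun e => \big[addb/false]_(y | t y) g y e) => x /negPf xr.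
rewrite exchange_big /=.
under eq_bigr do rewrite hg xr addbF.
rewrite big_mkcond (bigD1 x) //= eqxx big1; first by case: (t x).
by move=> y /negPf yx; rewrite eq_sym yx if_same.
Qed.

(** * Acyclic graphs are bipartite *)

(** A closed walk that repeats a vertex splits there into two shorter closed
    walks, one of which is again odd; one without repetition is a cycle. *)
Lemma acyclic_even_closed_walk : acyclic_graph G ->
  forall c : seq G, cycle (@adj G) c -> ~~ odd (size c).
Proof.
move=> acyc c; have [n] := ubnP (size c); elim: n c => // n IHn c ltn cyc.
apply/negP => oddc.
have [Uc|NUc] := boolP (uniq c).
  have [lt2|] := ltnP 2 (size c); first by apply: (acyc c lt2); rewrite /ucycle cyc.
  by case: c cyc oddc {Uc ltn} => [|x [|y []]] //=; rewrite adj_irr.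
have [a [x [p [q Ec]]]] : exists a x p q, c = a ++ x :: p ++ x :: q.
  elim: c NUc {ltn cyc oddc} => //= b c IHc.
  rewrite negb_and negbK => /orP[|/IHc[a [x [p [q ->]]]]]; last first.
    by exists (b :: a), x, p, q.
  by case/splitPr=> p q; exists [::], b, p, q.
have cyc2 : cycle (@adj G) (x :: p ++ x :: q ++ a).
  by move: cyc; rewrite Ec -(rot_cycle (size a)) rot_size_cat /= -catA.
move: cyc2; rewrite /= rcons_cat cat_path rcons_cons /= => /and3P[pxp lpx pxq].
have [cxp cxq] : cycle (@adj G) (x :: p) /\ cycle (@adj G) (x :: q ++ a).
  by rewrite /= rcons_path pxp lpx.
move: ltn oddc; rewrite Ec !size_cat /= size_cat /= => ltn.
have /IHn/(_ cxp) /negPf /= op : size (x :: p) < n.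
  rewrite -ltnS; apply: leq_trans ltn; rewrite /= !addnS !ltnS addnCA.
  by rewrite leq_addr.
have /IHn/(_ cxq) /negPf /= oq : size (x :: q ++ a) < n.
  rewrite -ltnS; apply: leq_trans ltn; rewrite /= size_cat !addnS !ltnS (addnC (size q)).
  by rewrite leq_add2l leq_addl.
move: op oq; rewrite size_cat !(oddD, addnS, oddS) /=.
by case: (odd (size a)); case: (odd (size p)); case: (odd (size q)).
Qed.

(** The side of a vertex is the parity of an arbitrary walk from [r] to it;
    the walks to two adjacent vertices and their edge form a closed walk. *)
Lemma tree_bipartite : tree G ->
  exists side : pred G, forall x y, adj x y -> side x != side y.
Proof.
case=> [[/card_gt0P[r _] conn] acyc].
have walk x : exists p, path (@adj G) r p /\ x = last r p.
  by have /connectP[p] := conn r x; exists p.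
have [w hw] := fin_all_exists walk.
exists (fun x => odd (size (w x))) => x y xy.
have [[px lx] [py ly]] := (hw x, hw y).
pose c := w x ++ y :: rev (belast r (w y)).
have lc : last r c = r.
  by rewrite last_cat /=; case: (w y) ly => [//|z p _]; rewrite rev_cons last_rcons.
have : cycle (@adj G) c.
  rewrite (cycle_path r) lc cat_path px -lx /= xy {1}ly rev_path.
  by rewrite (eq_path (e' := @adj G)) // => u v; rewrite /= adj_sym.
move/(acyclic_even_closed_walk acyc).
rewrite size_cat /= size_rev size_belast addnS oddS oddD.
by case: (odd (size (w x))); case: (odd (size (w y))).
Qed.

(** * Leaves *)

(** If every vertex had at least two neighbors, a path without repetition could
    always be extended at its first vertex [x], by a neighbor of [x] other than
    the next vertex: such a neighbor is new, as there are no cycles.  So these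
    paths could be arbitrarily long. *)
Lemma acyclic_has_leaf : acyclic_graph G -> 0 < #|G| ->
  exists x y, neighbors x \subset [set y].
Proof.
move=> acyc /card_gt0P[x0 _].
pose has_leaf := [exists x : G, exists y : G, neighbors x \subset [set y]].
have [/existsP[x /existsP[y xy]]|/existsPn noleaf] := boolP has_leaf.
  by exists x, y.
have long n : exists x p, [/\ path (@adj G) x p, uniq (x :: p) & size p = n].
  elim: n => [|n [x [p [xp Up sp]]]]; first by exists x0, [::].
  (* For a path reduced to [x], [head x p] is [x] itself, which is harmless
     because [x] is not its own neighbor. *)
  have /existsPn/(_ (head x p)) /subsetPn[y] := noleaf x.
  rewrite !inE => xy yNh; exists y, (x :: p).
  rewrite /= xp adj_sym xy sp; split=> //; move: (Up); rewrite /= => ->.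
  rewrite andbT inE negb_or; apply/andP; split.
    by apply: contraTneq xy => ->; rewrite adj_irr.
  apply/negP => yp; move: yNh Up xp; case/splitPr: yp => [[|z p1] p2] /=.
    by rewrite eqxx.
  move=> _ Up xp; apply: (acyc [:: x, z & rcons p1 y]).
    by rewrite /= size_rcons.
  move: xp Up; rewrite /ucycle /= -!cat_rcons cat_path => /and3P[xz zp _].
  rewrite xz rcons_path zp last_rcons adj_sym xy /=.
  rewrite !inE !mem_cat cat_uniq !negb_or.
  by case/and3P=> /and3P[-> -> _] /andP[-> _] /and3P[-> _ _].
have [x [p [_ Up sp]]] := long #|G|.
by have := max_card (mem (x :: p)); rewrite (card_uniqP Up) /= sp ltnn.
Qed.

(** Otherwise [x] and [y] would have only each other as neighbors, and would
    be all the vertices of the connected graph. *)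
Lemma connected_leaf_degree x y :
  (forall u v : G, connect (@adj G) u v) -> 2 < #|G| -> adj x y ->
  neighbors x \subset [set y] -> degree x < degree y.
Proof.
move=> conn n3 xy Nx; apply: leq_ltn_trans (subset_leq_card Nx) _.
rewrite cards1 ltnNge; apply/negP => /card_le1_eqP dy.
have yx : x \in neighbors y by rewrite inE adj_sym.
have cl u v : adj u v -> u \in [set x; y] -> v \in [set x; y].
  rewrite !inE => uv /orP[] /eqP Eu; rewrite {}Eu in uv.
    by have /subsetP/(_ v) := Nx; rewrite !inE uv => /(_ isT) ->; rewrite orbT.
  by rewrite (dy x v) ?inE ?eqxx // adj_sym.
have symG : connect_sym (@adj G) by apply: sym_connect_sym; apply: adj_sym.
have all2 u : u \in [set x; y].
  by rewrite -(closed_connect (intro_closed symG cl) (conn x u)) set21.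
have : #|G| <= #|[set x; y]| by apply/subset_leq_card/subsetP => u _; apply: all2.
by rewrite cards2; case: (x != y) => /(leq_trans n3).
Qed.

(** Every edge at the leaf [x] joins it to [y], and so contributes to the weight
    of [y] as well. *)
Lemma weight_leaf_lt g x y :
  neighbors x \subset [set y] -> degree x < degree y ->
  weight (edge_coloring g) x < weight (edge_coloring g) y.
Proof.
move=> Nx dxy; rewrite !weight_edge_coloring -addSn leq_add //.
  by rewrite !ltnS ltn_double.
rewrite big_mkcond [leqRHS]big_mkcond leq_sum // => e _.
case: ifP => // /edge_other_end[z xz ->]; rewrite !inE.
by have /subsetP/(_ z) := Nx; rewrite !inE xz => /(_ isT)/eqP ->; rewrite eqxx orbT.
Qed.

Lemma tree_NFSD2 : tree G -> 2 < #|G| -> has_NFSD G 2.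
Proof.
move=> treeG n3; have [[n0 conn] acyc] := treeG.
have [side sideN] := tree_bipartite treeG.
have [r [y0 Nr]] := acyclic_has_leaf acyc n0.
have [g hg] := exists_edge_parity side (fun x => conn x r).
pose f := edge_coloring g.
have ltr y : adj r y -> weight f r < weight f y.
  move=> ry; have Ey : y = y0.
    by have /subsetP/(_ y) := Nr; rewrite !inE ry => /(_ isT)/eqP.
  rewrite -Ey in Nr.
  by apply: weight_leaf_lt => //; apply: connected_leaf_degree ry Nr.
(* The vertices and the fixed shift of the edges contribute the odd number
   [1 + 2 * degree x], so the parity is opposite to that of the sum of [g]. *)
have oddw x : x != r -> odd (weight f x) = ~~ side x.
  move=> xr; rewrite weight_edge_coloring oddD /= odd_double -(hg x xr).
  by rewrite (big_morph odd oddD (erefl _)); under eq_bigr do rewrite oddb.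
exists f; split=> [[z|e] //=|x y xy E]; first by case: (g e).
have [Ex|xr] := eqVneq x r.
  by have := ltr y; rewrite -Ex E ltnn => /(_ xy).
have [Ey|yr] := eqVneq y r.
  by have := ltr x; rewrite -Ey E ltnn adj_sym => /(_ xy).
have := sideN x y xy; rewrite -(inj_eq negb_inj) -!oddw //.
by rewrite E eqxx.
Qed.

End Graph.

Theorem theorem12 (T : sgraph) (hT : tree T) (hn : 3 <= #|T|) :
  ((~ exists x y : T, adj x y /\ degree x = degree y) -> is_fgndi T 1) /\
  ((exists x y : T, adj x y /\ degree x = degree y) -> is_fgndi T 2).
Proof.
split=> [nodeg|deg]; split=> //.
- exact/has_NFSD1P.
- exact: tree_NFSD2.
by case=> [|[|j]] // _ /has_NFSD1P.
Qed.
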